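(* Let $0<p\le 1$ and let $(X,\|\cdot\|_p)$ be a finite-dimensional real complete $p$-normed space with $\dim X\ge 2$. Then for every $t\in[0,\tfrac12)$, $$t^{2p}+(1-t)^{2p}\;\le\; L_p(t,X)\;\le\;\frac{1}{2^{2p-1}}\bigl(1+(1-2t)^p\bigr)^2 .$$
   Context: A $p$-norm on a real vector space $X$ is a map $\|\cdot\|_p:X\to[0,\infty)$ such that (i) $\|x\|_p=0$ iff $x=0$; (ii) $\|\lambda x\|_p=|\lambda|^p\|x\|_p$ for all $\lambda\in\mathbb{R}$, $x\in X$; (iii) $\|x+y\|_p\le\|x\|_p+\|y\|_p$ for all $x,y\in X$. A (complete) $p$-normed space is a vector space with such a $p$-norm (complete for the metric $\|x-y\|_p$). Elements $x,y\in X$ are isosceles orthogonal, written $x\perp_I y$, iff $\|x+y\|_p=\|x-y\|_p$. For $t\in[0,\tfrac12)$, $$L_p(t,X)=\sup\left\{\frac{\|tx+(1-t)y\|_p^2+\|(1-t)x+ty\|_p^2}{\|x+y\|_p^2}: x,y\in X,\ (x,y)\ne(0,0),\ x\perp_I y\right\}.$$ *)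

(* Defs.v *)
From HB Require Import structures.
From mathcomp Require Import all_boot all_order all_algebra.
From mathcomp Require Import all_classical all_reals all_analysis.

Set Implicit Arguments.
Unset Strict Implicit.
Unset Printing Implicit Defensive.
Import Order.TTheory GRing.Theory Num.Theory.
Import numFieldNormedType.Exports.
Local Open Scope classical_set_scope.
Local Open Scope ring_scope.

Record is_pnorm (R : realType) (X : lmodType R) (p : R) (nu : X -> R) : Prop :=
  IsPnorm {
    pnorm_ge0 : forall x, 0 <= nu x;
    pnorm_eq0 : forall x, nu x = 0 <-> x = 0;
    pnormZ : forall (a : R) x, nu (a *: x) = `|a| `^ p * nu x;
    pnormD : forall x y, nu (x + y) <= nu x + nu y
  }.

(* A vector space carries no canonical topology here, so completeness is stated
   directly for the metric (x, y) |-> nu (x - y). *)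
Definition pnorm_complete (R : realType) (X : lmodType R) (nu : X -> R) : Prop :=
  forall u : nat -> X,
    (forall e : R, 0 < e ->
       exists N : nat, forall m n : nat, (N <= m)%N -> (N <= n)%N ->
         nu (u m - u n) < e) ->
    exists l : X, nu (u n - l) @[n --> \oo] --> (0 : R).

Definition isosceles_orth (R : realType) (X : lmodType R) (nu : X -> R)
    (x y : X) : Prop :=
  nu (x + y) = nu (x - y).

(* The supremum is taken in \bar R, so that no default value is involved: a
   finite upper bound on Lp asserts that the quotients are bounded. For a
   p-norm the denominator never vanishes on the index set, since
   nu (x + y) = nu (x - y) = 0 forces x = y = 0. *)
Definition Lp (R : realType) (X : lmodType R) (nu : X -> R) (t : R) : \bar R :=
  ereal_sup [set ((nu (t *: xy.1 + (1 - t) *: xy.2) ^+ 2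
                   + nu ((1 - t) *: xy.1 + t *: xy.2) ^+ 2)
                  / nu (xy.1 + xy.2) ^+ 2)%:E
            | xy in [set xy : X * X |
                xy <> (0, 0) /\ isosceles_orth nu xy.1 xy.2]].

(* Main.v *)
Require Import Defs.
From HB Require Import structures.
From mathcomp Require Import all_boot all_order all_algebra.
From mathcomp Require Import all_classical all_reals all_analysis.
From mathcomp Require Import ring lra.

(** Lower bound: every [x] is isosceles orthogonal to [0], and by homogeneity
    the quotient of the pair [(x, 0)] with [x != 0] is exactly
    [t `^ (2 * p) + (1 - t) `^ (2 * p)]; a nonzero [x] exists because the
    dimension is positive.

    Upper bound: each of the two vectors in the numerator is
    [2^-1 *: (x + y) +- ((1 - 2 * t) / 2) *: (x - y)].  When [x] and [y] are
    isosceles orthogonal, [x + y] and [x - y] have the same p-norm, so the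
    triangle inequality and homogeneity ([pnorm_half_combination]) bound both
    p-norms by the same multiple [2^-1 `^ p * (1 + (1 - 2 * t) `^ p)] of
    [nu (x + y)].  Squaring and adding twice the same bound gives the factor
    [2 * 2^-1 `^ (2 * p) = 1 / 2 `^ (2 * p - 1)]. *)

Set Implicit Arguments.
Unset Strict Implicit.
Unset Printing Implicit Defensive.
Import Order.TTheory GRing.Theory Num.Theory.
Import numFieldNormedType.Exports.
Local Open Scope classical_set_scope.
Local Open Scope ring_scope.

Lemma powR_sqr (R : realType) (a p : R) : (a `^ p) ^+ 2 = a `^ (2 * p).
Proof. by rewrite -powR_mulrn ?powR_ge0// -powRrM mulrC. Qed.

Lemma two_half_powR_sqr (R : realType) (p : R) :
  2 * (2^-1 `^ p) ^+ 2 = 1 / 2 `^ (2 * p - 1).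
Proof.
rewrite powR_sqr div1r -powRN opprB powRD; last by rewrite pnatr_eq0 implybT.
by rewrite powRr1// -powR_inv1// -powRrM mulN1r.
Qed.

(** The triangle inequality and homogeneity suffice.  For [u = x + y] and
    [v = x - y] the hypothesis [nu u = nu v] is isosceles orthogonality of [x]
    and [y]. *)
Lemma pnorm_half_combination (R : realType) (X : lmodType R) (p : R)
    (nu : X -> R) (s c : R) (u v : X) :
  is_pnorm p nu -> nu u = nu v -> `|c| = 2^-1 * s -> 0 <= s ->
  nu (2^-1 *: u + c *: v) <= 2^-1 `^ p * (1 + s `^ p) * nu u.
Proof.
move=> nuP uv cE s0; apply: le_trans (pnormD nuP _ _) _.
rewrite !(pnormZ nuP) -uv cE ger0_norm ?invr_ge0// powRM ?invr_ge0//.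
by rewrite mulrDr mulr1 mulrDl.
Qed.

Lemma convex_combination_half (R : numFieldType) (X : lmodType R) (a : R)
    (x y : X) :
  a *: x + (1 - a) *: y = 2^-1 *: (x + y) + (a - 2^-1) *: (x - y).
Proof.
rewrite !scalerDr !scalerN addrACA -scalerDl -scalerBl.
by congr (_ *: _ + _ *: _); field.
Qed.

Theorem theorem3p1 (R : realType) (X : vectType R) (p : R) (nu : X -> R)
    (p_gt0 : 0 < p) (p_le1 : p <= 1)
    (nu_pnorm : is_pnorm p nu) (nu_complete : pnorm_complete nu)
    (dimX : (2 <= \dim (fullv : {vspace X}))%N)
    (t : R) (t_ge0 : 0 <= t) (t_lt_half : t < 1 / 2) :
  ((t `^ (2 * p) + (1 - t) `^ (2 * p))%:E <= Lp nu t)%E /\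
  (Lp nu t <= (1 / 2 `^ (2 * p - 1) * (1 + (1 - 2 * t) `^ p) ^+ 2)%:E)%E.
Proof.
have s_ge0 : 0 <= 1 - 2 * t by lra.
split.
- pose x : X := vpick fullv.
  have x_neq0 : x != 0 by rewrite vpick0 -dimv_eq0 -lt0n (ltn_trans _ dimX).
  have nux_neq0 : nu x != 0.
    by apply: contra_neq x_neq0 => /(pnorm_eq0 nu_pnorm).
  apply: ereal_sup_ubound; exists (x, 0).
    split; first by case=> x0; rewrite x0 eqxx in x_neq0.
    by rewrite /isosceles_orth /= addr0 subr0.
  rewrite /= !scaler0 !addr0 !(pnormZ nu_pnorm) !ger0_norm//; last by lra.
  by rewrite !exprMn -mulrDl mulfK ?sqrf_eq0// !powR_sqr.
- apply: ge_ereal_sup => _ [[x y] /= [_ xy] <-]; rewrite lee_fin.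
  set K := 2^-1 `^ p * (1 + (1 - 2 * t) `^ p).
  have -> : 1 / 2 `^ (2 * p - 1) * (1 + (1 - 2 * t) `^ p) ^+ 2 = 2 * K ^+ 2.
    by rewrite -two_half_powR_sqr exprMn -mulrA.
  have sqr_le (c : R) : `|c| = 2^-1 * (1 - 2 * t) ->
      nu (2^-1 *: (x + y) + c *: (x - y)) ^+ 2 <= K ^+ 2 * nu (x + y) ^+ 2.
    move=> cE; rewrite -exprMn lerXn2r ?nnegrE ?(pnorm_ge0 nu_pnorm)//.
      by rewrite !mulr_ge0 ?addr_ge0 ?powR_ge0 ?(pnorm_ge0 nu_pnorm).
    exact: pnorm_half_combination nu_pnorm xy cE s_ge0.
  have le1 : nu (t *: x + (1 - t) *: y) ^+ 2 <= K ^+ 2 * nu (x + y) ^+ 2.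
    rewrite convex_combination_half; apply: sqr_le.
    by rewrite ler0_norm; [field | lra].
  have le2 : nu ((1 - t) *: x + t *: y) ^+ 2 <= K ^+ 2 * nu (x + y) ^+ 2.
    rewrite -[X in _ + X *: y](subKr 1) convex_combination_half; apply: sqr_le.
    by rewrite ger0_norm; [field | lra].
  have [nu0|nu_neq0] := eqVneq (nu (x + y)) 0.
    (* With the convention [0^-1 = 0] the quotient is then [0]. *)
    by rewrite nu0 expr0n invr0 mulr0 mulr_ge0 ?sqr_ge0.
  rewrite ler_pdivrMr ?exprn_even_gt0// -mulrA mulr_natl mulr2n.
  exact: lerD.
Qed.
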